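(* Let $n\ge 2$, let $u\in S_n$ and let $\beta=(i_1,\dots,i_k)\in[n-1]^k$ be a braid word containing a reduced word of $u$ as a subword (i.e. $u_0=\mathrm{id}$ in the notation of the context). Let $m$ and $f$ be the numbers of mutable and frozen bridges of the 3D plabic graph $G_{u,\beta}$, and let $\widehat{B}^{u,\beta}=H^{u,\beta}+D^{u,\beta}$ be the $(m+f)\times(m+f)$ matrix defined in the context. Then every entry of $\widehat{B}^{u,\beta}$ is an integer and $\det \widehat{B}^{u,\beta}=(-1)^{m+f}$.
   Context: Demazure sequence. For $v\in S_n$ and a simple transposition $s_i$, put $v\lhd s_i=vs_i$ if $\ell(vs_i)<\ell(v)$ and $v\lhd s_i=v$ otherwise. Given $u\in S_n$ and a braid word $\beta=(i_1,\dots,i_k)$ (representing the positive braid $\sigma_{i_1}\cdots\sigma_{i_k}$), set $u_k=u$ and $u_{j-1}=u_j\lhd s_{i_j}$ for $j=k,\dots,1$; the standing assumption is $u_0=\mathrm{id}$. Let $J=\{l\in[k]: u_l=u_{l-1}\}$. 3D plabic graph (planar projection). Draw $n$ horizontal strands; the strip between the $l$-th and $(l+1)$-st strand (counted from the bottom) is gap $l$, $1\le l\le n-1$. For positions $j=1,\dots,k$ from left to right, draw a vertical edge (a bridge) in gap $i_j$ if $j\in J$, and otherwise a positive crossing of the two strands bounding gap $i_j$. The faces of this picture are the regions; the $n-1$ regions touching the left border are the boundary regions, the $l$-th lying in gap $l$. Soap films. To every bridge $d$ is attached a soap film $C_d$ (the relative cycle of Galashin–Lam–Sherman-Bennett–Speyer's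 3D plabic graph construction), covering each region with multiplicity $\mathrm{mult}_R(C_d)\in\{0,1\}$. It starts at $d$, covering the region of gap $i_d$ immediately to the left of $d$, and propagates to the left clinging to the strands it is attached to; through crossings it follows these strands; on reaching a bridge in gap $i$ it continues unchanged if it passes over the upper strand or under the lower strand of that bridge, and otherwise its part in gap $i$ is cut off there (its parts in gaps $i\pm1$ continue). A bridge is mutable if its film ends before the left border (is bounded) and frozen otherwise; $m$, $f$ denote the numbers of mutable and frozen bridges. Index the films $C_1,\dots,C_{m+f}$: first the mutable ones ordered left to right by the position of their bridge, then the frozen ones left to right. Vertex $j$ of the quiver $Q_{u,\beta}$ corresponds to $C_j$; vertices $1,\dots,m$ are mutable, $m+1,\dots,m+f$ frozen. Half-arrow matrix. At each bridge, lying in gap $i$, let $P_L,P_R$ be the regions of gap $i$ immediately left and right of it, $P_A$ the region of gap $i+1$ touching its upper endpoint and $P_C$ the region of gap $i-1$ touching its lower endpoint (when these gaps exist). Place six half arrows: two $P_L\to P_R$, and one each $P_R\to P_A$, $P_A\to P_L$, $P_R\to P_C$, $P_C\to P_L$. There are no half arrows at crossings. Define $H^{u,\beta}=(h_{ij})_{1\le i,j\le m+f}$ by $h_{ij}=\tfrac12\sum_{\text{half arrows }P\to P'}\big(\mathrm{mult}_P(C_i)\mathrm{mult}_{P'}(C_j)-\mathrm{mult}_P(C_j)\mathrm{mult}_{P'}(C_i)\big)$. (The quiver $Q_{u,\beta}$ has $h_{ij}$ as signed number of arrows $i\to j$ when $i,j$ are not both frozen; its extended exchange matrix is $\widetilde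 B=(h_{ij})_{1\le i\le m+f,\,1\le j\le m}$.) Boundary correction. For a film $C_j$ let $\partial(C_j)\in\{0,1\}^{n-1}$ have $l$-th coordinate equal to the multiplicity of $C_j$ on the $l$-th boundary region. On $\mathbb{Z}^{n-1}$ let $(a,b)=a^TMb$, where $M$ is $-\tfrac12$ times the Cartan matrix of type $A_{n-1}$: $M_{ii}=-1$, $M_{i,i\pm1}=\tfrac12$, all other entries $0$. Let $D^{u,\beta}=(D_{ij})$ with $D_{ij}=(\partial(C_i),\partial(C_j))$, and $\widehat{B}^{u,\beta}=H^{u,\beta}+D^{u,\beta}$. *)

(* Defs.v *)
From mathcomp Require Import all_boot all_order all_algebra all_fingroup.
Set Implicit Arguments.
Unset Strict Implicit.
Unset Printing Implicit Defensive.
Import Order.TTheory GRing.Theory Num.Theory.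

(* Strands are 'I_n and gaps are 'I_n.-1, both numbered from 0 and from the
   bottom: gap i lies between strand (lo i), of height i, and strand (hi i), of
   height i.+1.  A braid word is a tuple of gaps; its letters are numbered by
   'I_k.  Letter j separates the vertical slices j and j.+1 of the picture, and
   slice 0 is the left border, slice k the right one. *)

Lemma lo_subproof n (i : 'I_n.-1) : i < n.
Proof. exact: leq_trans (ltn_ord i) (leq_pred n). Qed.

Lemma hi_subproof n (i : 'I_n.-1) : i.+1 < n.
Proof. by rewrite -ltn_predRL. Qed.

Definition lo n (i : 'I_n.-1) : 'I_n := Ordinal (lo_subproof i).
Definition hi n (i : 'I_n.-1) : 'I_n := Ordinal (hi_subproof i).

Definition simple_refl n (i : 'I_n.-1) : 'S_n := tperm (lo i) (hi i).

Definition perm_length n (v : 'S_n) : nat :=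
  #|[set p : 'I_n * 'I_n | (p.1 < p.2) && (v p.2 < v p.1)]|.

(* The product of perm.v composes from left to right, so that the function
   v \o s_i is the group element s_i * v. *)
Definition demazure n (v : 'S_n) (i : 'I_n.-1) : 'S_n :=
  let w := (simple_refl i * v)%g in
  if perm_length w < perm_length v then w else v.

Section Graph.

Variables (n k : nat) (u : 'S_n) (beta : k.-tuple 'I_n.-1).

(* demazure_seq t is u_t, for 0 <= t <= k. *)
Definition demazure_seq (t : nat) : 'S_n :=
  foldr (fun i v => demazure v i) u (drop t beta).

Definition is_bridge (j : 'I_k) : bool :=
  demazure_seq j.+1 == demazure_seq j.

(* The trace of a film on a vertical slice.  At a given slice the strands are
   named by their heights.  A strand with exactly one covered adjacent gap is
   an edge of the film; a strand with both adjacent gaps covered is passed by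
   the film, over it or under it according to film_over, which carries no
   information about the other strands. *)
Record film_slice := FilmSlice {
  film_gaps : {set 'I_n.-1};
  film_over : {set 'I_n} }.

Definition covers_above (x : film_slice) (s : 'I_n) : bool :=
  [exists i in film_gaps x, lo i == s].
Definition covers_below (x : film_slice) (s : 'I_n) : bool :=
  [exists i in film_gaps x, hi i == s].
Definition passes (x : film_slice) (s : 'I_n) : bool :=
  covers_below x s && covers_above x s.
Definition passes_over (x : film_slice) (s : 'I_n) : bool :=
  passes x s && (s \in film_over x).
Definition passes_under (x : film_slice) (s : 'I_n) : bool :=
  passes x s && (s \notin film_over x).

(* From the right to the left of a bridge in gap i. *)
Definition bridge_step (i : 'I_n.-1) (x : film_slice) : film_slice :=
  if passes_over x (hi i) || passes_under x (lo i) then x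
  else FilmSlice (film_gaps x :\ i) (film_over x).

(* From the right to the left of a crossing in gap i.  The strand p of height
   i goes to height i.+1, and the strand q of height i.+1 goes to height i,
   q being in front of p.  The gaps other than i are not affected, and gap i is
   covered on the left exactly when this makes p and q edges of the film on the
   left iff they are edges of it on the right; both strands give the same
   condition.  When p is passed on the left but not on the right, the film has
   its lower edge on q and is stretched over p; when q is passed on the left
   but not on the right, the film has its upper edge on p and is stretched
   under q. *)
Definition crossing_step (i : 'I_n.-1) (x : film_slice) : film_slice :=
  let p_over := if passes x (lo i) then lo i \in film_over x else true in
  let q_over := if passes x (hi i) then hi i \in film_over x else false in
  let covered :=
    covers_below x (lo i) (+) (i \in film_gaps x) (+) covers_above x (hi i) in
  FilmSlice
    [set l | if l == i then covered else l \in film_gaps x]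
    [set s | if s == hi i then p_over
             else if s == lo i then q_over
             else s \in film_over x].

Definition film_step (j : 'I_k) (x : film_slice) : film_slice :=
  if is_bridge j then bridge_step (tnth beta j) x
  else crossing_step (tnth beta j) x.

(* The film of the bridge d at slice t <= d, starting from slice d, which is
   immediately to the left of d. *)
Definition film (d : 'I_k) (t : nat) : film_slice :=
  foldr film_step (FilmSlice [set tnth beta d] set0)
    [seq j : 'I_k <- enum 'I_k | t <= j < d].

(* The pair (l, t) stands for the region of gap l that meets slice t; two
   slices meet the same region of gap l when no letter between them is equal
   to l.  By mult_region, mult only depends on the region. *)
Definition region := ('I_n.-1 * nat)%type.

Definition mult (d : 'I_k) (P : region) : nat :=
  (P.2 <= d) && (P.1 \in film_gaps (film d P.2)).

Lemma mult_region (d j : 'I_k) (l : 'I_n.-1) :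
  tnth beta j != l -> mult d (l, j : nat) = mult d (l, j.+1).
Proof.
move=> jl; rewrite /mult /=; case: (ltngtP j d) => [jd|//|/val_inj jd] /=.
  have -> : film d j = film_step j (film d j.+1).
    rewrite /film.
    suff -> : [seq i : 'I_k <- enum 'I_k | j <= i < d] =
              j :: [seq i : 'I_k <- enum 'I_k | j < i < d] by [].
    apply: (inj_map val_inj); rewrite /=.
    have E a : [seq val i | i : 'I_k <- [seq i : 'I_k <- enum 'I_k | a <= i < d]] =
               [seq i <- iota 0 k | a <= i < d].
      by rewrite -val_enum_ord filter_map.
    rewrite !E; apply: (irr_sorted_eq ltn_trans ltnn).
    - exact/(sorted_filter ltn_trans)/iota_ltn_sorted.
    - rewrite /= path_sortedE; last exact: ltn_trans.
      rewrite (sorted_filter ltn_trans _ (iota_ltn_sorted _ _)) andbT.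
      by apply/allP => i; rewrite mem_filter => /andP[/andP[]].
    move=> i; rewrite inE !mem_filter mem_iota /= add0n.
    by case: (ltngtP j i) => //= <-; rewrite jd ltn_ord.
  rewrite /film_step; case: ifP => _.
    rewrite /bridge_step; case: ifP => //= _.
    by rewrite in_setD1 (eq_sym l) jl.
  by rewrite /crossing_step /= inE (eq_sym l) (negbTE jl).
rewrite jd; suff -> : film d d = FilmSlice [set tnth beta d] set0.
  by rewrite /= in_set1 -jd eq_sym (negbTE jl).
rewrite /film; suff -> : [seq i : 'I_k <- enum 'I_k | d <= i < d] = [::] by [].
by rewrite (eq_filter (a2 := pred0)) ?filter_pred0 // => i; case: ltngtP.
Qed.

Definition bounded_film (d : 'I_k) : bool := film_gaps (film d 0) == set0.

Definition mutable_bridges : seq 'I_k :=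
  [seq d <- enum 'I_k | is_bridge d && bounded_film d].
Definition frozen_bridges : seq 'I_k :=
  [seq d <- enum 'I_k | is_bridge d && ~~ bounded_film d].

Definition n_mutable : nat := size mutable_bridges.
Definition n_frozen : nat := size frozen_bridges.

Definition bridges : (n_mutable + n_frozen).-tuple 'I_k :=
  [tuple of in_tuple mutable_bridges ++ in_tuple frozen_bridges].

Definition half_arrows_at (j : 'I_k) : seq (region * region) :=
  let i := tnth beta j in
  let PL : region := (i, j : nat) in
  let PR : region := (i, j.+1) in
  let neighbours :=
    [seq ((l, j : nat) : region)
       | l : 'I_n.-1 <- enum 'I_n.-1 & (l == i.+1 :> nat) || (l.+1 == i :> nat)] in
  [:: (PL, PR); (PL, PR)]
    ++ flatten [seq [:: (PR, P); (P, PL)] | P <- neighbours].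

Definition half_arrows : seq (region * region) :=
  flatten [seq half_arrows_at j | j <- enum 'I_k & is_bridge j].

Local Open Scope ring_scope.

Definition half_arrow_mx : 'M[rat]_(n_mutable + n_frozen) :=
  \matrix_(i, j)
    let c := tnth bridges i in
    let d := tnth bridges j in
    2^-1 * \sum_(a <- half_arrows)
      ((mult c a.1)%:R * (mult d a.2)%:R - (mult d a.1)%:R * (mult c a.2)%:R).

Definition film_boundary (d : 'I_k) : 'cV[rat]_n.-1 :=
  \col_l (mult d (l, 0%N))%:R.

Definition boundary_form : 'M[rat]_n.-1 :=
  \matrix_(i, j)
    if i == j then -1
    else if (j == i.+1 :> nat) || (i == j.+1 :> nat) then 2^-1 else 0.

Definition boundary_mx : 'M[rat]_(n_mutable + n_frozen) :=
  \matrix_(i, j)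
    ((film_boundary (tnth bridges i))^T *m boundary_form
       *m film_boundary (tnth bridges j)) 0 0.

Definition Bhat : 'M[rat]_(n_mutable + n_frozen) := half_arrow_mx + boundary_mx.

End Graph.

(* Main.v *)
Require Import Defs.
From mathcomp Require Import all_boot all_order all_algebra all_fingroup.
From mathcomp Require Import zify ring.
Import GRing.Theory Num.Theory.
Local Open Scope ring_scope.

(* Let (x, y) be the boundary form, evaluated on the gap vectors of two films at
   a vertical slice.  At a bridge in gap i, the half arrows contribute to h_cd
   exactly the change of (x, y) across the bridge plus W_cj * b_jd, where b_jd is
   the change of film d in gap i and W_cj only depends on film c.  At a crossing,
   both films change by the reflection of gap i, so (x, y) is unchanged.  Hence
   the changes telescope to minus the boundary correction and Bhat = W * b, with
   W and b integral and triangular for the order of the bridges from left to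
   right, with diagonal entries 1 and -1.

   The reflection property needs that films never meet a crossing with their two
   edges, or with two facing edges, on the crossing strands.  This follows from
   an invariant: if a strand that is a film edge or passed under lies below a
   strand that is a film edge or passed over, these two strands do not cross
   further left. *)

Set Implicit Arguments.
Unset Strict Implicit.
Unset Printing Implicit Defensive.

(** * Inversions and the Demazure action *)

Section Permutations.

Variables (n : nat).
Implicit Types (v : 'S_n) (i l : 'I_n.-1) (s : 'I_n).

Lemma lo_inj : injective (@lo n).
Proof. by move=> i l [] /val_inj. Qed.

Lemma hi_inj : injective (@hi n).
Proof. by move=> i l [] /val_inj. Qed.

Lemma lo_neq_hi i : (lo i == hi i) = false.
Proof. by rewrite -val_eqE /=; lia. Qed.

Lemma simple_refl_lo i : simple_refl i (lo i) = hi i.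
Proof. exact: tpermL. Qed.

Lemma simple_refl_hi i : simple_refl i (hi i) = lo i.
Proof. exact: tpermR. Qed.

Lemma simple_refl_off i s : s != lo i -> s != hi i -> simple_refl i s = s.
Proof. by move=> sl sh; rewrite tpermD // eq_sym. Qed.

Lemma simple_refl_ltn i (a b : 'I_n) :
  (a < b)%N -> (a, b) != (lo i, hi i) -> (simple_refl i a < simple_refl i b)%N.
Proof.
rewrite xpair_eqE /simple_refl.
case: tpermP => [->|->|/eqP + /eqP +]; case: tpermP => [->|->|/eqP + /eqP +];
  by rewrite -?val_eqE /= ?eqxx => *; lia.
Qed.

(** Applying the transposition to both entries injects the inversions of [v] into those of
    [simple_refl i * v]. The new inversion [(lo i, hi i)] is not in the image: its preimage would be
    the decreasing pair [(hi i, lo i)]. *)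
Lemma perm_length_simple_refl v i :
  (v (lo i) < v (hi i))%N -> (perm_length v < perm_length (simple_refl i * v)%g)%N.
Proof.
move=> lt_v; rewrite /perm_length.
set I := [set p | _]; set I' := [set p | _].
pose g (p : 'I_n * 'I_n) := (simple_refl i p.1, simple_refl i p.2).
have g_inj : injective g by move=> [a b] [c d] [/perm_inj-> /perm_inj->].
rewrite -(card_imset I g_inj); apply/proper_card/properP; split.
  apply/subsetP => _ /imsetP[[a b] /[!inE] /= /andP[ab vba] ->].
  rewrite !permM !tpermK vba andbT simple_refl_ltn //.
  by apply/eqP => -[aE bE]; move: vba lt_v; rewrite aE bE; lia.
exists (lo i, hi i).
  by rewrite inE /= !permM simple_refl_lo simple_refl_hi lt_v ltnSn.
apply/imsetP => -[[a b]]; rewrite inE /= => /andP[ab _] [aE bE].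
move: ab; rewrite -(tpermK (lo i) (hi i) a) -(tpermK (lo i) (hi i) b).
by rewrite -/(simple_refl i) -aE -bE simple_refl_lo simple_refl_hi /=; lia.
Qed.

Lemma perm_length_simple_reflE v i :
  (perm_length (simple_refl i * v)%g < perm_length v)%N = (v (hi i) < v (lo i))%N.
Proof.
case: (ltngtP (v (hi i)) (v (lo i))) => [lt_v|lt_v|/ord_inj/perm_inj/eqP]; last by rewrite eq_sym lo_neq_hi.
  have := @perm_length_simple_refl (simple_refl i * v)%g i.
  by rewrite !permM simple_refl_lo simple_refl_hi mulgA tperm2 mul1g => ->.
by apply/negbTE; rewrite -leqNgt ltnW // perm_length_simple_refl.
Qed.

Lemma demazure_eq v i : (v == demazure v i) = (v (lo i) < v (hi i))%N.
Proof.
rewrite /demazure perm_length_simple_reflE.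
case: (ltngtP (v (hi i)) (v (lo i))) => [lt_v|_|/ord_inj/perm_inj/eqP].
- apply/eqP => /permP /(_ (lo i)); rewrite permM simple_refl_lo => vE.
  by move: lt_v; rewrite vE ltnn.
- by rewrite eqxx.
- by rewrite eq_sym lo_neq_hi.
Qed.

Lemma demazure_neq v i :
  v != demazure v i -> (v (hi i) < v (lo i))%N /\ demazure v i = (simple_refl i * v)%g.
Proof. by rewrite /demazure perm_length_simple_reflE; case: ifP => //; rewrite eqxx. Qed.

End Permutations.

(** * Local rules for film slices and the monotonicity invariant *)

Section Slices.

Variables (n : nat).
Implicit Types (w : 'S_n) (i l : 'I_n.-1) (s : 'I_n) (x y : film_slice n).

Lemma covers_above_lo x i : covers_above x (lo i) = (i \in film_gaps x).
Proof.
apply/exists_inP/idP => [[l lx /eqP/lo_inj <-] //|ix]; by exists i.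
Qed.

Lemma covers_below_hi x i : covers_below x (hi i) = (i \in film_gaps x).
Proof.
apply/exists_inP/idP => [[l lx /eqP/hi_inj <-] //|ix]; by exists i.
Qed.

Lemma covers_above_off x y i s :
  (forall l, l != i -> (l \in film_gaps x) = (l \in film_gaps y)) ->
  s != lo i -> covers_above x s = covers_above y s.
Proof.
move=> xy si; apply: eq_existsb => l; have [->|/xy->//] := eqVneq l i.
by rewrite eq_sym (negbTE si) !andbF.
Qed.

Lemma covers_below_off x y i s :
  (forall l, l != i -> (l \in film_gaps x) = (l \in film_gaps y)) ->
  s != hi i -> covers_below x s = covers_below y s.
Proof.
move=> xy si; apply: eq_existsb => l; have [->|/xy->//] := eqVneq l i.
by rewrite eq_sym (negbTE si) !andbF.
Qed.

Definition film_edge x s := covers_below x s (+) covers_above x s.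

(** A film edge satisfies both this predicate and the next one, a passed strand exactly one of them,
    and any other strand neither. *)
Definition edge_or_under x s := film_edge x s || passes_under x s.
Definition edge_or_over x s := film_edge x s || passes_over x s.

(* w s is the height at which the strand of height s meets the left border;
   two strands cross further left exactly when w reverses their order. *)
Definition monotone_slice w x :=
  forall s s' : 'I_n, (s < s')%N -> edge_or_under x s -> edge_or_over x s' ->
  (w s < w s')%N.

Section CrossingStep.

Variables (x : film_slice n) (i : 'I_n.-1).
Let y := crossing_step i x.

Lemma crossing_gaps_off l : l != i -> (l \in film_gaps y) = (l \in film_gaps x).
Proof. by rewrite inE => /negbTE->. Qed.

Lemma crossing_gapsE :
  (i \in film_gaps y) =
  covers_below x (lo i) (+) (i \in film_gaps x) (+) covers_above x (hi i).
Proof. by rewrite inE eqxx. Qed.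

Let below_lo : covers_below y (lo i) = covers_below x (lo i).
Proof. by apply: (covers_below_off (i := i) crossing_gaps_off); rewrite lo_neq_hi. Qed.

Let above_hi : covers_above y (hi i) = covers_above x (hi i).
Proof. by apply: (covers_above_off (i := i) crossing_gaps_off); rewrite eq_sym lo_neq_hi. Qed.

Let over_lo :
  (lo i \in film_over y) = if passes x (hi i) then hi i \in film_over x else false.
Proof. by rewrite inE lo_neq_hi eqxx. Qed.

Let over_hi :
  (hi i \in film_over y) = if passes x (lo i) then lo i \in film_over x else true.
Proof. by rewrite inE eqxx. Qed.

Lemma crossing_off s : s != lo i -> s != hi i ->
  edge_or_under y s = edge_or_under x s /\ edge_or_over y s = edge_or_over x s.
Proof.
move=> sl sh; rewrite /edge_or_under /edge_or_over /film_edge /passes_under /passes_over /passes.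
rewrite (covers_below_off (i := i) crossing_gaps_off) //.
rewrite (covers_above_off (i := i) crossing_gaps_off) //.
by rewrite inE (negbTE sl) (negbTE sh).
Qed.

(** The strand of height [hi i] on the left has height [lo i] on the right. It is an edge on both
    sides or on neither, and if it is newly passed, the default value makes it passed over, which
    the hypothesis excludes. *)
Lemma crossing_under_hi : edge_or_under y (hi i) -> edge_or_under x (lo i).
Proof.
rewrite /edge_or_under /film_edge /passes_under over_hi /passes above_hi.
rewrite !covers_below_hi covers_above_lo crossing_gapsE.
by case: (covers_below _ _); case: (i \in _); case: (covers_above _ _); case: (lo i \in _).
Qed.

Lemma crossing_over_lo : edge_or_over y (lo i) -> edge_or_over x (hi i).
Proof.
rewrite /edge_or_over /film_edge /passes_over over_lo /passes below_lo.
rewrite !covers_below_hi covers_above_lo crossing_gapsE.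
by case: (covers_below _ _); case: (i \in _); case: (covers_above _ _); case: (hi i \in _).
Qed.

(** The strand continues as [hi i] on the right. The second alternative arises when it is newly
    passed under: the film then has its upper edge on [lo i] and is stretched below the other
    strand. *)
Lemma crossing_under_lo :
  edge_or_under y (lo i) -> edge_or_under x (hi i) || edge_or_under x (lo i).
Proof.
rewrite /edge_or_under /film_edge /passes_under over_lo /passes below_lo.
rewrite !covers_below_hi !covers_above_lo crossing_gapsE.
by case: (covers_below _ _); case: (i \in _); case: (covers_above _ _); case: (hi i \in _).
Qed.

Lemma crossing_over_hi :
  edge_or_over y (hi i) -> edge_or_over x (lo i) || edge_or_over x (hi i).
Proof.
rewrite /edge_or_over /film_edge /passes_over over_hi /passes above_hi.
rewrite !covers_below_hi !covers_above_lo crossing_gapsE.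
by case: (covers_below _ _); case: (i \in _); case: (covers_above _ _); case: (lo i \in _).
Qed.

Lemma monotone_crossing_step w :
  (w (hi i) < w (lo i))%N -> monotone_slice w x ->
  monotone_slice (simple_refl i * w)%g y.
Proof.
move=> lt_w mono s s' ss' s_under s'_over; rewrite !permM.
have [sE|sl] := eqVneq s (lo i); [|have [sE|sh] := eqVneq s (hi i)].
- have [s'E|s'h] := eqVneq s' (hi i).
    by rewrite sE s'E simple_refl_lo simple_refl_hi.
  have s'gt : (hi i < s')%N.
    by move: ss' s'h; rewrite sE -val_eqE /=; lia.
  have s'l : s' != lo i by rewrite -val_eqE /=; move: s'gt => /=; lia.
  rewrite sE simple_refl_lo simple_refl_off //.
  move: s_under s'_over; rewrite sE (crossing_off s'l s'h).2.
  move=> /crossing_under_lo/orP[|] su s'o; first exact: mono su s'o.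
  (* Here the film is stretched under the crossing strand: the bound is known for the larger value
     [w (lo i)], hence holds for [w (hi i)]. *)
  by apply: ltn_trans lt_w (mono _ _ _ su s'o); rewrite -sE.
- have s'h : s' != hi i by rewrite -val_eqE -sE /=; lia.
  have s'l : s' != lo i by rewrite -val_eqE; move: ss'; rewrite sE /=; lia.
  rewrite sE simple_refl_hi simple_refl_off //.
  move: s_under s'_over; rewrite sE (crossing_off s'l s'h).2.
  move=> /crossing_under_hi; apply: mono.
  by move: ss'; rewrite sE /=; lia.
rewrite (simple_refl_off sl sh); rewrite (crossing_off sl sh).1 in s_under.
have [s'E|s'l] := eqVneq s' (lo i); [|have [s'E|s'h] := eqVneq s' (hi i)].
- rewrite s'E simple_refl_lo; rewrite s'E in s'_over.
  apply: mono (s_under) (crossing_over_lo s'_over).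
  by move: ss'; rewrite s'E /=; lia.
- rewrite s'E simple_refl_hi; rewrite s'E in s'_over.
  have sl' : (s < lo i)%N by move: ss' sl; rewrite s'E -val_eqE /=; lia.
  have /orP[s'o|s'o] := crossing_over_hi s'_over; first exact: mono s_under s'o.
  by apply: ltn_trans (mono _ _ _ s_under s'o) lt_w; rewrite -s'E.
by rewrite simple_refl_off //; apply: mono => //; rewrite -(crossing_off s'l s'h).2.
Qed.

(* A film whose upper and lower edges are about to cross, or with two pieces
   whose facing edges are about to cross, would violate monotonicity; in all
   other cases the parity rule of crossing_step is an integer reflection. *)
Lemma crossing_gaps_nat w :
  (w (hi i) < w (lo i))%N -> monotone_slice w x ->
  ((i \in film_gaps y) + (i \in film_gaps x) =
   covers_below x (lo i) + covers_above x (hi i))%N.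
Proof.
move=> lt_w mono; have := mono (lo i) (hi i) (ltnSn i).
rewrite ltnNge ltnW //= /edge_or_under /edge_or_over /film_edge.
rewrite covers_above_lo covers_below_hi crossing_gapsE.
case: (covers_below x (lo i)); case: (i \in _); case: (covers_above x (hi i)) => //=;
  by move=> /(_ isT isT).
Qed.

End CrossingStep.

(** A cut can newly make only [lo i] an edge or passed under, and only [hi i] an edge or passed
    over. Before a cut of a covered gap, [hi i] was an edge or passed under and [lo i] an edge or
    passed over, so the old invariant compares them with the outer strands; chaining with
    [w (lo i) < w (hi i)] settles the new pairs. *)
Lemma monotone_bridge_step w x i :
  (w (lo i) < w (hi i))%N -> monotone_slice w x -> monotone_slice w (bridge_step i x).
Proof.
move=> lt_w mono; rewrite /bridge_step; case: ifP => // /negbT.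
rewrite negb_or => /andP[not_over not_under].
set y := FilmSlice _ _.
have gaps_off l : l != i -> (l \in film_gaps y) = (l \in film_gaps x).
  by move=> li; rewrite in_setD1 li.
have off_under s : s != lo i -> edge_or_under y s -> edge_or_under x s.
  move=> sl; rewrite /edge_or_under /film_edge /passes_under /passes.
  rewrite (covers_above_off gaps_off sl).
  have [->|sh] := eqVneq s (hi i); last by rewrite (covers_below_off gaps_off sh).
  move: not_over; rewrite /passes_over /passes !covers_below_hi in_setD1 eqxx /=.
  by case: (covers_above _ _); case: (_ \in _); case: (_ \in _).
have off_over s : s != hi i -> edge_or_over y s -> edge_or_over x s.
  move=> sh; rewrite /edge_or_over /film_edge /passes_over /passes.
  rewrite (covers_below_off gaps_off sh).
  have [->|sl] := eqVneq s (lo i); last by rewrite (covers_above_off gaps_off sl).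
  move: not_under; rewrite /passes_under /passes !covers_above_lo in_setD1 eqxx /=.
  by case: (covers_below _ _); case: (_ \in _); case: (_ \in _).
(* If gap [i] is not covered, the cut changes nothing. *)
have [ix|nix] := boolP (i \in film_gaps x); last first.
  have -> : y = x.
    by case: x @y nix {mono not_over not_under gaps_off off_under off_over} => g o /= nix;
       congr FilmSlice; apply/setDidPl; rewrite disjoint_sym disjoints1.
  by [].
have hi_under : edge_or_under x (hi i).
  move: not_over; rewrite /edge_or_under /film_edge /passes_under /passes_over /passes.
  rewrite covers_below_hi ix /=.
  by case: (covers_above _ _); case: (_ \in _).
have lo_over : edge_or_over x (lo i).
  move: not_under; rewrite /edge_or_over /film_edge /passes_under /passes_over /passes.
  rewrite covers_above_lo ix /=.
  by case: (covers_below _ _); case: (_ \in _).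
have from_hi s' : (hi i <= s')%N -> edge_or_over y s' -> (w (hi i) <= w s')%N.
  rewrite leq_eqVlt => /orP[/eqP/val_inj <- //|hs'] s'o.
  apply/ltnW/(mono _ _ hs' hi_under)/off_over => //.
  by rewrite -val_eqE /=; move: hs' => /=; lia.
have to_lo s : (s <= lo i)%N -> edge_or_under y s -> (w s <= w (lo i))%N.
  rewrite leq_eqVlt => /orP[/eqP/val_inj -> //|hs'] s'o.
  apply/ltnW/(mono _ _ hs' _ lo_over)/off_under => //.
  by rewrite -val_eqE /=; move: hs' => /=; lia.
move=> s s' ss' su s'o.
have [sE|sl] := eqVneq s (lo i).
  rewrite sE; apply: leq_trans lt_w (from_hi _ _ s'o).
  by move: ss'; rewrite sE.
have [s'E|s'h] := eqVneq s' (hi i).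
  rewrite s'E; apply: leq_ltn_trans lt_w; apply: to_lo su.
  by move: ss'; rewrite s'E.
by apply: mono ss' (off_under _ sl su) (off_over _ s'h s'o).
Qed.

Lemma monotone_start w i :
  (w (lo i) < w (hi i))%N -> monotone_slice w (FilmSlice [set i] set0).
Proof.
move=> lt_w; set x := FilmSlice _ _.
have above s : covers_above x s = (s == lo i).
  by apply/exists_inP/eqP => [[l /set1P-> /eqP]|->] //; exists i; rewrite ?set11.
have below s : covers_below x s = (s == hi i).
  by apply/exists_inP/eqP => [[l /set1P-> /eqP]|->] //; exists i; rewrite ?set11.
have touched s b : film_edge x s || passes x s && b -> s = lo i \/ s = hi i.
  rewrite /film_edge /passes above below.
  by case: eqVneq => [->|_]; case: eqVneq => [->|_]; rewrite //=; auto.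
move=> s s' ss' /touched[] sE /touched[] s'E; move: ss'; rewrite sE s'E //=; lia.
Qed.

End Slices.

(** * Films along the braid word *)

Section Films.

Variables (n k : nat) (u : 'S_n) (beta : k.-tuple 'I_n.-1).
Implicit Types (i l : 'I_n.-1) (c d j : 'I_k) (t : nat).

Local Notation w := (demazure_seq u beta).
Local Notation film := (film u beta).
Local Notation is_bridge := (is_bridge u beta).
Local Notation mult := (mult u beta).

Lemma demazure_seq_rec j : w j = demazure (w j.+1) (tnth beta j).
Proof.
by rewrite /demazure_seq (drop_nth (tnth beta j)) ?size_tuple //= -tnth_nth.
Qed.

Lemma bridgeP j : is_bridge j = (w j.+1 (lo (tnth beta j)) < w j.+1 (hi (tnth beta j)))%N.
Proof. by rewrite /Defs.is_bridge demazure_seq_rec demazure_eq. Qed.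

Lemma film_start d : film d d = FilmSlice [set tnth beta d] set0.
Proof.
rewrite /Defs.film (eq_filter (a2 := pred0)) ?filter_pred0 // => i.
by case: ltngtP.
Qed.

Lemma film_rec d j : (j < d)%N -> film d j = film_step u beta j (film d j.+1).
Proof.
move=> jd; rewrite /Defs.film.
suff -> : [seq i : 'I_k <- enum 'I_k | (j <= i < d)%N] =
          j :: [seq i : 'I_k <- enum 'I_k | (j < i < d)%N] by [].
pose ltI : rel 'I_k := relpre val ltn.
have ltI_tr : transitive ltI by move=> ? ? ?; apply: ltn_trans.
have mem_enum_filter (P : pred 'I_k) (i : 'I_k) : (i \in [seq x <- enum 'I_k | P x]) = P i.
  by rewrite mem_filter mem_enum andbT.
have ltI_irr : irreflexive ltI by move=> ?; apply: ltnn.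
have enum_sorted : sorted ltI (enum 'I_k).
  by rewrite -sorted_map val_enum_ord iota_ltn_sorted.
apply: (irr_sorted_eq ltI_tr ltI_irr).
- exact: sorted_filter.
- rewrite /= path_sortedE // sorted_filter // andbT.
  by apply/allP => i; rewrite mem_filter => /andP[/andP[]].
move=> i; rewrite inE !mem_enum_filter -val_eqE /=.
by case: (ltngtP j i) => // <-.
Qed.

(** Induction leftwards from [d]. At a bridge the permutation is unchanged and increasing on the two
    strands; at a crossing it is decreasing on them and is multiplied by the transposition. These
    are the hypotheses of the two step lemmas. *)
Lemma monotone_film d t : is_bridge d -> (t <= d)%N -> monotone_slice (w t) (film d t).
Proof.
move=> d_bridge; elim: {t}(d - t)%N {-2}t (erefl (d - t)%N) => [|m IHm] t.
  move=> /eqP; rewrite subn_eq0 => dt td.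
  have -> : t = d by apply/eqP; rewrite eqn_leq td dt.
  rewrite film_start; apply: monotone_start.
  by move: (d_bridge) => /eqP <-; rewrite -bridgeP.
move=> dtm _; have td : (t < d)%N by lia.
have := IHm t.+1 ltac:(lia) td.
pose j := Ordinal (ltn_trans td (ltn_ord d)); rewrite -[t]/(j : nat).
rewrite (@film_rec d j td) /film_step; case: ifPn => [jb|jb].
  by move: (jb) => /eqP <-; apply: monotone_bridge_step; rewrite -bridgeP.
move: (jb); rewrite /Defs.is_bridge demazure_seq_rec => /demazure_neq[lt_w ->].
exact: monotone_crossing_step.
Qed.

Lemma mult_start d l : mult d (l, d : nat) = (l == tnth beta d).
Proof. by rewrite /Defs.mult leqnn film_start in_set1. Qed.

Lemma mult_right d t l : (d < t)%N -> mult d (l, t) = 0%N.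
Proof. by move=> dt; rewrite /Defs.mult /= [(t <= d)%N]leqNgt dt. Qed.

Definition adjacent i l := (l == i.+1 :> nat) || (l.+1 == i :> nat).

Lemma adjacent_neq i l : adjacent i l -> l != i.
Proof. by rewrite /adjacent -val_eqE /=; lia. Qed.

Lemma sum_mem_exists (T : finType) (P : pred T) (A : {set T}) :
  {in P &, forall x y, x = y} ->
  (\sum_(x | P x) (x \in A) = [exists x in A, P x])%N.
Proof.
move=> P1; case: exists_inP => [[x xA Px]|nP].
  rewrite (bigD1 x) //= xA big1 // => y /andP[Py /eqP yx].
  by case: yx; apply: P1.
by rewrite big1 // => x Px; case: (boolP (x \in A)) => // xA; case: nP; exists x.
Qed.

Lemma sum_adjacent_gaps (x : film_slice n) i :
  (\sum_(l | adjacent i l) (l \in film_gaps x) =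
   covers_below x (lo i) + covers_above x (hi i))%N.
Proof.
(* At most one adjacent gap lies on each side of gap [i], so each part of the sum is a Boolean; it
   is empty at the border of the picture. *)
rewrite (bigID (fun l => hi l == lo i)) /=; congr addn.
  rewrite -sum_mem_exists => [|l l' /eqP lE /eqP l'E]; last first.
    by apply: hi_inj; rewrite lE l'E.
  by apply: eq_bigl => l; rewrite -val_eqE /adjacent /=; lia.
rewrite -sum_mem_exists => [|l l' /eqP lE /eqP l'E]; last first.
  by apply: lo_inj; rewrite lE l'E.
by apply: eq_bigl => l; rewrite -!val_eqE /adjacent /=; lia.
Qed.

(** For a film starting right of the crossing this is the integer reflection rule; for one starting
    left of it all terms vanish. *)
Lemma mult_crossing d j : is_bridge d -> ~~ is_bridge j ->
  let i := tnth beta j in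
  (mult d (i, j : nat) + mult d (i, j.+1) =
   \sum_(l | adjacent i l) mult d (l, j.+1))%N.
Proof.
move=> db jb i; case: (ltngtP d j) => [dj|jd|/val_inj dj]; last by rewrite -dj db in jb.
  rewrite !mult_right ?leqW // big1 // => l _.
  by rewrite mult_right // leqW.
rewrite /Defs.mult /= (ltnW jd) jd /= sum_adjacent_gaps film_rec // /film_step (negbTE jb).
have mono := monotone_film db jd.
move: (jb); rewrite /Defs.is_bridge demazure_seq_rec => /demazure_neq[lt_w _].
exact: crossing_gaps_nat lt_w mono.
Qed.

(** * The boundary form and the reflections at crossings *)

Definition film_vec d t : 'cV[rat]_n.-1 := \col_l (mult d (l, t))%:R.

Local Notation M := (boundary_form n).

Definition form (x y : 'cV[rat]_n.-1) : rat := (x^T *m M *m y) 0 0.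

Definition unit_vec i : 'cV[rat]_n.-1 := delta_mx i 0.

Definition nbr_sum i (x : 'cV[rat]_n.-1) : rat := \sum_(l | adjacent i l) x l 0.

Lemma formDl x x' y : form (x + x') y = form x y + form x' y.
Proof. by rewrite /form linearD /= !mulmxDl mxE. Qed.

Lemma formDr x y y' : form x (y + y') = form x y + form x y'.
Proof. by rewrite /form mulmxDr mxE. Qed.

Lemma formZl a x y : form (a *: x) y = a * form x y.
Proof. by rewrite /form linearZ /= -!scalemxAl mxE. Qed.

Lemma formZr a x y : form x (a *: y) = a * form x y.
Proof. by rewrite /form -scalemxAr mxE. Qed.

Lemma form_sym x y : form x y = form y x.
Proof.
have Msym : M^T = M.
  by apply/matrixP => i l; rewrite !mxE eq_sym orbC.
by rewrite /form -[in LHS](trmxK y) -{1}Msym -mulmxA -!trmx_mul mxE.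
Qed.

Lemma form_unit i y : form (unit_vec i) y = - y i 0 + 2^-1 * nbr_sum i y.
Proof.
rewrite /form /unit_vec trmx_delta -rowE -row_mul mxE mxE (bigD1 i) //= mxE eqxx mulN1r.
congr (_ + _); rewrite /nbr_sum mulr_sumr big_mkcond [RHS]big_mkcond /=.
apply: eq_bigr => l _; rewrite mxE eq_sym; case: eqVneq => [->|_].
  by case: ifP => // /adjacent_neq; rewrite eqxx.
rewrite /adjacent (eq_sym (nat_of_ord i)); case: ifP => //; rewrite ?mul0r //.
Qed.

Lemma form_unit_unit i : form (unit_vec i) (unit_vec i) = -1.
Proof.
rewrite form_unit /nbr_sum big1 ?mulr0 ?addr0 => [|l /adjacent_neq li].
  by rewrite mxE !eqxx.
by rewrite mxE (negbTE li).
Qed.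

Lemma form_shift i a b x y :
  form (x + a *: unit_vec i) (y + b *: unit_vec i) =
  form x y + a * form (unit_vec i) y + b * form (unit_vec i) x - a * b.
Proof.
rewrite !formDl !formDr !formZl !formZr form_unit_unit (form_sym x (unit_vec i)).
by ring.
Qed.

(** As [unit_vec i] has square -1, [refl] is the orthogonal reflection in it. *)
Lemma form_reflection i x y :
  let refl z := z + (2 * form (unit_vec i) z) *: unit_vec i in
  form (refl x) (refl y) = form x y.
Proof. by rewrite /= form_shift; ring. Qed.

Lemma film_vec_right d t : (d < t)%N -> film_vec d t = 0.
Proof. by move=> dt; apply/colP => l; rewrite !mxE mult_right. Qed.

Lemma film_vec_step d j :
  let i := tnth beta j in
  film_vec d j.+1 =
  film_vec d j + (film_vec d j.+1 i 0 - film_vec d j i 0) *: unit_vec i.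
Proof.
move=> i; apply/colP => l; rewrite !mxE eqxx andbT.
have [->|li] := eqVneq l i; first by rewrite mulr1 addrC subrK.
by rewrite mulr0 addr0 (mult_region u) // eq_sym.
Qed.

Lemma nbr_sum_step d j :
  let i := tnth beta j in nbr_sum i (film_vec d j) = nbr_sum i (film_vec d j.+1).
Proof.
move=> i; apply: eq_bigr => l /adjacent_neq li.
by rewrite !mxE (mult_region u) // eq_sym.
Qed.

(** By [mult_crossing] the coordinate at the crossing becomes the neighbour sum minus its old value,
    which is what the reflection does. *)
Lemma film_vec_crossing d j : is_bridge d -> ~~ is_bridge j ->
  let e := unit_vec (tnth beta j) in
  film_vec d j.+1 = film_vec d j + (2 * form e (film_vec d j)) *: e.
Proof.
move=> db jb; rewrite /= {1}film_vec_step form_unit nbr_sum_step.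
congr (_ + _ *: _); have := congr1 (fun m => m%:R : rat) (mult_crossing db jb).
rewrite /= natrD natr_sum /nbr_sum => E.
under [in RHS]eq_bigr do rewrite mxE.
by rewrite -E !mxE; field.
Qed.

Lemma form_crossing c d j : is_bridge c -> is_bridge d -> ~~ is_bridge j ->
  form (film_vec c j.+1) (film_vec d j.+1) = form (film_vec c j) (film_vec d j).
Proof. by move=> cb db jb; rewrite !film_vec_crossing // form_reflection. Qed.

(** * Half arrows and the factorization *)

Definition film_jump j d : rat :=
  (mult d (tnth beta j, j.+1))%:R - (mult d (tnth beta j, j : nat))%:R.

(** This is minus the form of the unit vector of the gap of [j] with the sum of the two vectors of
    [c] on either side of [j]. *)
Definition film_weight c j : rat :=
  (mult c (tnth beta j, j : nat))%:R + (mult c (tnth beta j, j.+1))%:R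
  - \sum_(l | adjacent (tnth beta j) l) (mult c (l, j : nat))%:R.

(** Let a and b be the jumps of [c] and [d], and e the unit vector; take film vectors left of [j].
    The arrows give a(e,d) - b(e,c), while the form changes by a(e,d) + b(e,c) - ab. The difference
    b(a - 2(e,c)) is the jump of [d] times the weight of [c]. *)
Lemma half_arrow_sum c d j :
  2^-1 * \sum_(a <- half_arrows_at beta j)
    ((mult c a.1)%:R * (mult d a.2)%:R - (mult d a.1)%:R * (mult c a.2)%:R) =
  form (film_vec c j.+1) (film_vec d j.+1) - form (film_vec c j) (film_vec d j)
  + film_weight c j * film_jump j d :> rat.
Proof.
set i := tnth beta j.
rewrite (film_vec_step c j) (film_vec_step d j) -/i form_shift !form_unit.
rewrite /half_arrows_at big_cat !big_cons big_nil big_flatten /= big_map big_map.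
rewrite big_filter big_enum_cond /= -/i.
under eq_bigr => l _ do rewrite !big_cons big_nil /=.
have -> (F G : 'I_n.-1 -> rat) (a b a' b' : rat) :
   \sum_(l | adjacent i l) (a * G l - b * F l + (F l * b' - G l * a' + 0)) =
   (a - a') * (\sum_(l | adjacent i l) G l) + (b' - b) * \sum_(l | adjacent i l) F l.
  rewrite !mulr_sumr -big_split; apply: eq_bigr => l _ /=; ring.
rewrite /film_weight /film_jump -/i /nbr_sum !mxE.
under [X in _ = (_ + _ * (_ + _ * X) + _ - _ - _ + _)]eq_bigr do rewrite mxE.
under [X in _ = (_ + _ + _ * (_ + _ * X) - _ - _ + _)]eq_bigr do rewrite mxE.
by field.
Qed.

(** Listing mutable bridges first only permutes the bridges, so sums over matrix indices become sums
    over letters. *)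
Lemma perm_bridges : perm_eq (bridges u beta) [seq j <- enum 'I_k | is_bridge j].
Proof.
rewrite /= /mutable_bridges /frozen_bridges.
rewrite (eq_filter (a2 := predI (bounded_film u beta) is_bridge)); last first.
  by move=> j; rewrite /= andbC.
rewrite [X in _ ++ X](eq_filter (a2 := predI (predC (bounded_film u beta)) is_bridge)).
  by rewrite !filter_predI; apply/permPl/perm_filterC.
by move=> j; rewrite /= andbC.
Qed.

Local Notation N := (n_mutable u beta + n_frozen u beta)%N.
Local Notation br := (tnth (bridges u beta)).

Lemma sum_bridges (F : 'I_k -> rat) : \sum_(j | is_bridge j) F j = \sum_(p < N) F (br p).
Proof.
by rewrite -(big_tuple _ _ (bridges u beta) xpredT F) (perm_big _ perm_bridges) big_filter big_enum_cond.
Qed.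

Lemma bridges_is_bridge p : is_bridge (br p).
Proof.
by have := mem_tnth p (bridges u beta); rewrite (perm_mem perm_bridges) mem_filter => /andP[].
Qed.

Lemma bridges_inj : injective br.
Proof.
by apply/tuple_uniqP; rewrite (perm_uniq perm_bridges) filter_uniq // enum_uniq.
Qed.

Definition weight_mx : 'M[rat]_N := \matrix_(p, q) film_weight (br p) (br q).
Definition jump_mx : 'M[rat]_N := \matrix_(p, q) film_jump (br p) (br q).

Lemma Bhat_factor : Bhat u beta = weight_mx *m jump_mx.
Proof.
apply/matrixP => p q; rewrite /Bhat mxE [in RHS]mxE.
rewrite [half_arrow_mx _ _ _ _]mxE [boundary_mx _ _ _ _]mxE /=.
under [RHS]eq_bigr => r _ do rewrite !mxE.
rewrite -(sum_bridges (fun j => film_weight (br p) j * film_jump j (br q))).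
pose F t := form (film_vec (br p) t) (film_vec (br q) t).
rewrite -/(F 0%N) /half_arrows big_flatten /= big_map big_filter big_enum_cond /= mulr_sumr.
rewrite (eq_bigr _ (fun j _ => half_arrow_sum (br p) (br q) j)).
rewrite big_split /= addrAC -[RHS]add0r; congr (_ + _).
(* Crossings leave [F] unchanged, so they can be added to the sum, which then telescopes. [F k]
   vanishes because every film starts left of slice [k], and the remaining [- F 0] cancels the
   boundary entry. *)
have -> : \sum_(j | is_bridge j) (F j.+1 - F j) = \sum_(j < k) (F j.+1 - F j).
  rewrite [RHS](bigID is_bridge) /= [X in _ + X]big1 ?addr0 // => j jb.
  by rewrite /F form_crossing ?bridges_is_bridge ?subrr.
rewrite -(big_mkord xpredT (fun t => F t.+1 - F t)) telescope_sumr //.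
have -> : F k = 0 by rewrite /F film_vec_right // /form trmx0 !mul0mx mxE.
by rewrite sub0r addNr.
Qed.

(** * Triangularity and the determinant *)

Lemma film_jump_left j d : (d < j)%N -> film_jump j d = 0.
Proof. by move=> dj; rewrite /film_jump !mult_right ?leqW // subrr. Qed.

Lemma film_jump_self d : film_jump d d = -1.
Proof. by rewrite /film_jump mult_right // mult_start eqxx sub0r. Qed.

Lemma film_weight_right c j : (c < j)%N -> film_weight c j = 0.
Proof.
move=> cj; rewrite /film_weight !mult_right ?leqW // big1 ?subr0 ?addr0 // => l _.
by rewrite mult_right.
Qed.

Lemma film_weight_self c : film_weight c c = 1.
Proof.
rewrite /film_weight mult_start eqxx mult_right // big1 ?subr0 ?addr0 // => l.
by move=> /adjacent_neq li; rewrite mult_start (negbTE li).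
Qed.

End Films.

(** The rank [f] is there because the factors are triangular for the positions of the bridges, not
    for the indexing with mutable bridges first. In the Leibniz formula every permutation other than
    the identity raises [f] somewhere, so its term vanishes. *)
Lemma det_trig_rank (R : comNzRingType) (m : nat) (f : 'I_m -> nat) (A : 'M[R]_m) :
  injective f -> (forall i j, (f i < f j)%N -> A i j = 0) ->
  \det A = \prod_i A i i.
Proof.
move=> f_inj A0; rewrite /determinant (bigD1 1%g) //= odd_perm1 expr0 mul1r.
rewrite [X in _ + X]big1 ?addr0; first by apply: eq_bigr => i _; rewrite perm1.
move=> s s_neq1; have [i lt_i] : exists i, (f i < f (s i))%N.
  apply/existsP; apply: contraR s_neq1; rewrite negb_exists => /forallP le_s.
  (* If [f] is raised nowhere, equality of the total sums of [f] and of [f] after [s] forces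
     equality at each index, and injectivity gives the identity. *)
  have le i : (f (s i) <= f i ?= iff (f (s i) == f i))%N.
    by split; rewrite // leqNgt.
  have [_ ] := leqif_sum (fun i (_ : true) => le i).
  rewrite -(reindex_inj (@perm_inj _ s) (P := xpredT) (F := f)) eqxx.
  move=> /esym/forallP eq_s; apply/eqP/permP => i.
  by rewrite perm1; apply: f_inj; apply/eqP; have := eq_s i.
by rewrite (bigD1 i) //= A0 // mul0r mulr0.
Qed.

Theorem theorem3p5 (n k : nat) (u : 'S_n) (beta : k.-tuple 'I_n.-1) :
  (2 <= n)%N ->
  demazure_seq u beta 0 = 1%g ->
  (forall i j, Bhat u beta i j \is a Num.int) /\
  \det (Bhat u beta) = (-1) ^+ (n_mutable u beta + n_frozen u beta).
Proof.
move=> _ _; rewrite Bhat_factor; split.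
  move=> p q; rewrite mxE; apply: rpred_sum => r _; rewrite !mxE.
  by rewrite rpredM // ?rpredB ?rpredD ?rpred_sum // => *; rewrite natr_int.
have br_inj : injective (fun p => tnth (bridges u beta) p : nat).
  by move=> p q /ord_inj/bridges_inj.
(* The two factors are triangular in opposite directions; transposing the second lets one criterion
   serve for both. *)
rewrite det_mulmx -[\det (jump_mx _ _)]det_tr.
rewrite (det_trig_rank br_inj) => [|p q lt_pq]; last by rewrite mxE film_weight_right.
rewrite (det_trig_rank br_inj) => [|p q lt_pq]; last by rewrite !mxE film_jump_left.
rewrite big1 ?mul1r => [|p _]; last by rewrite mxE film_weight_self.
under eq_bigr => p _ do rewrite !mxE film_jump_self.
by rewrite prodr_const card_ord.
Qed.
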